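(* Let $\mathcal{M}_d$ denote the set of $0/1$-matrices of rank $d$ with no repeated row and no repeated column. A matrix in $\mathcal{M}_d$ is \emph{maximal} if it is not a submatrix of another matrix in $\mathcal{M}_d$. Then the number of maximal elements of $\mathcal{M}_d$, counted up to permutation of rows and columns, is $2^{O(d^3)}$.
   Context: Rank is over the reals. A submatrix of a matrix is obtained by deleting some of its rows and some of its columns. *)

(* Defs.v *)
From mathcomp Require Import all_boot all_order all_algebra all_fingroup.
From mathcomp Require Import boolp classical_sets functions cardinality reals.

Set Implicit Arguments.
Unset Strict Implicit.
Unset Printing Implicit Defensive.

Import GRing.Theory.

Local Open Scope classical_set_scope.
Local Open Scope ring_scope.

(* A 0/1-matrix of arbitrary size; true stands for 1 and false for 0. *)
Record zo_matrix := ZoMatrix {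
  nrows : nat;
  ncols : nat;
  entries :> 'M[bool]_(nrows, ncols)
}.

Definition real_rank (R : realType) (A : zo_matrix) : nat :=
  \rank (map_mx (fun b : bool => b%:R : R) A).

Definition zo_rank_matrices (R : realType) (d : nat) : set zo_matrix :=
  [set A | [/\ real_rank R A = d,
               injective (fun i => row i A) &
               injective (fun j => col j A)]].

(* Deleting rows and columns keeps the remaining ones in their order, hence
   the strictly increasing selections f and g. *)
Definition submatrix (A B : zo_matrix) : Prop :=
  exists (f : 'I_(nrows A) -> 'I_(nrows B)) (g : 'I_(ncols A) -> 'I_(ncols B)),
    [/\ {homo f : i j / (i < j)%N},
        {homo g : i j / (i < j)%N} &
        entries A = mxsub f g B].

Definition maximal_matrices (R : realType) (d : nat) : set zo_matrix :=
  [set A | zo_rank_matrices R d A /\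
           ~ exists B, [/\ zo_rank_matrices R d B, B <> A & submatrix A B]].

Definition perm_class (A : zo_matrix) : set zo_matrix :=
  [set B | exists (s : 'S_(nrows A)) (t : 'S_(ncols A)),
             B = ZoMatrix (row_perm s (col_perm t A))].

Definition maximal_classes (R : realType) (d : nat) : set (set zo_matrix) :=
  [set perm_class A | A in maximal_matrices R d].

(* Main.v *)
Require Import Defs.
From mathcomp Require Import all_boot all_order all_algebra all_fingroup.
From mathcomp Require Import boolp classical_sets functions cardinality reals.

(** Fix a nonsingular [d] x [d] submatrix [M] of a rank [d] matrix [A]. Rows and
columns of [A] become vectors [a], [b] in [{0,1}^d] (their restrictions to the
columns, resp. rows, of [M]), and the corresponding entry of [A] is
[v = a M^-1 b^T]. If [A] is maximal, its columns are exactly the [b] for which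
[v] is 0 or 1 against every row of [A], and vice versa, so [A] is determined up
to permutations by [M] and the set of its [b]. The condition [v^2 = v] is linear
in the [d^2] products [b_i b_j] (as [b_i = b_i^2]), so at most [d^2] of the rows
[a] suffice to cut out the set of columns. Hence [d^2 + d^3] bits determine the
class of [A]. *)

Set Implicit Arguments.
Unset Strict Implicit.
Unset Printing Implicit Defensive.

Import GRing.Theory.

Lemma col_mulmx (R : pzSemiRingType) m n p (A : 'M[R]_(m, n)) (B : 'M[R]_(n, p)) j :
  (col j (A *m B) = A *m col j B)%R.
Proof. by apply/colP=> i; rewrite !mxE; apply: eq_bigr => k _; rewrite !mxE. Qed.

Lemma leq_ord_inj m n (h : 'I_m -> 'I_n) : injective h -> m <= n.
Proof. by move=> /leq_card; rewrite !card_ord. Qed.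

(** * Entries as values of a bilinear form on row and column codes *)

Section Pairing.
Variable R : realType.
Local Open Scope ring_scope.

Definition rmx m n (A : 'M[bool]_(m, n)) : 'M[R]_(m, n) :=
  map_mx (fun b : bool => b%:R : R) A.

Lemma boolR_inj : injective (fun b : bool => b%:R : R).
Proof.
by case=> -[] // /eqP; rewrite ?oner_eq0 // eq_sym oner_eq0.
Qed.

Definition pairing d (M : 'M[bool]_d) (a b : 'rV[bool]_d) : R :=
  (rmx a *m invmx (rmx M) *m (rmx b)^T) 0 0.

Definition compat d (M : 'M[bool]_d) (a b : 'rV[bool]_d) : Prop :=
  pairing M a b ^+ 2 = pairing M a b.

Lemma compatP d (M : 'M[bool]_d) (a b : 'rV[bool]_d) :
  compat M a b <-> exists t : bool, pairing M a b = t%:R.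
Proof.
rewrite /compat; split=> [/eqP|[[] ->]]; last 2 first.
- by rewrite expr1n.
- by rewrite expr0n.
rewrite -subr_eq0 expr2 -{3}[pairing M a b]mulr1 -mulrBr mulf_eq0 subr_eq0.
by case/orP=> /eqP ->; [exists false | exists true].
Qed.

(** A scalar equals its transpose. This symmetry lets facts about columns follow from facts about
    rows. *)
Lemma pairing_tr d (M : 'M[bool]_d) (a b : 'rV[bool]_d) :
  pairing M^T b a = pairing M a b.
Proof.
rewrite /pairing -trace_mx11 -mxtrace_tr trace_mx11.
by rewrite !trmx_mul trmxK trmx_inv mulmxA /rmx -map_trmx trmxK.
Qed.

Lemma compat_tr d (M : 'M[bool]_d) (a b : 'rV[bool]_d) :
  compat M^T b a <-> compat M a b.
Proof. by rewrite /compat pairing_tr. Qed.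

Definition rowcode d m n (A : 'M[bool]_(m, n)) (g : 'I_d -> 'I_n) (i : 'I_m) :
  'rV[bool]_d := \row_k A i (g k).

Definition colcode d m n (A : 'M[bool]_(m, n)) (f : 'I_d -> 'I_m) (j : 'I_n) :
  'rV[bool]_d := \row_k A (f k) j.

(** [f] and [g] may list rows and columns in any order; invertibility of [M] makes them
    injective. *)
Definition frame d m n (A : 'M[bool]_(m, n)) (M : 'M[bool]_d)
    (f : 'I_d -> 'I_m) (g : 'I_d -> 'I_n) : Prop :=
  [/\ rmx M \in unitmx, mxsub f g A = M &
      forall i j, (A i j)%:R = pairing M (rowcode A g i) (colcode A f j)].

Lemma frame_tr d m n (A : 'M[bool]_(m, n)) (M : 'M[bool]_d) f g :
  frame A M f g -> frame A^T M^T g f.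
Proof.
case=> uM MA prA; split; first by rewrite /rmx -map_trmx unitmx_tr.
  by rewrite -MA trmx_mxsub.
move=> i j; rewrite mxE prA -pairing_tr.
by congr (pairing _ _ _); apply/rowP=> k; rewrite !mxE.
Qed.

(** Let [f] pick a row basis of [B = rmx A] and [g] a column basis of these rows. Then
    [B = X *m rowsub f B], and restriction to the columns [g] gives [X] as [colsub g B] times the
    inverse of [M]. *)
Lemma exists_frame d m n (A : 'M[bool]_(m, n)) :
  \rank (rmx A) = d -> exists M f g, @frame d m n A M f g.
Proof.
move=> <-; set B := rmx A; pose f := maxrankfun B.
have fullB : row_full (rowsub f B)^T.
  by rewrite /row_full mxrank_tr; exact: maxrowsub_free.
pose g := fullrankfun fullB.
have rM : rmx (mxsub f g A) = mxsub f g B by rewrite /B /rmx map_mxsub.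
have uM : rmx (mxsub f g A) \in unitmx.
  rewrite rM -unitmx_tr trmx_mxsub.
  suff <- : rowsub g (rowsub f B)^T = mxsub g f B^T by exact: fullrowsub_unit.
  by apply/matrixP=> i j; rewrite !mxE.
exists (mxsub f g A), f, g; split=> // i j.
have /submxP[X BX] : (B <= rowsub f B)%MS by rewrite eq_maxrowsub.
have XE : colsub g B = X *m rmx (mxsub f g A).
  have /(congr1 (colsub g)) -> := BX.
  rewrite -mulmx_colsub rM; congr (X *m _).
  by apply/matrixP=> k l; rewrite !mxE.
have XE' : X = colsub g B *m invmx (rmx (mxsub f g A)) by rewrite XE mulmxK.
have -> : (A i j)%:R = B i j by rewrite mxE.
have -> : B i j = (X *m rowsub f B) i j by rewrite -BX.
rewrite XE' /pairing.
set N := invmx _.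
have -> : rmx (rowcode A g i) = row i (colsub g B).
  by apply/rowP=> k; rewrite !mxE.
have -> : (rmx (colcode A f j))^T = col j (rowsub f B).
  by apply/colP=> k; rewrite !mxE.
by rewrite -!row_mul -col_mulmx [RHS]mxE [RHS]mxE.
Qed.

Lemma frame_compat d m n (A : 'M[bool]_(m, n)) (M : 'M[bool]_d) f g i j :
  frame A M f g -> compat M (rowcode A g i) (colcode A f j).
Proof. by case=> _ _ prA; apply/compatP; exists (A i j); rewrite -prA. Qed.

(** The pairing makes each row a function of its code. *)
Lemma rowcode_inj d m n (A : 'M[bool]_(m, n)) (M : 'M[bool]_d) f g :
  frame A M f g -> injective (fun i => row i A) -> injective (rowcode A g).
Proof.
case=> _ _ prA injA i i' eqi; apply: injA; apply/rowP=> j; rewrite !mxE.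
by apply: boolR_inj; rewrite /= !prA eqi.
Qed.

(** The code of the column [g k] is the [k]-th column of [M], which the inverse of [M] turns into a
    unit vector. *)
Lemma frame_pairing d m n (A : 'M[bool]_(m, n)) (M : 'M[bool]_d) f g a k :
  frame A M f g -> pairing M a (colcode A f (g k)) = (a 0 k)%:R.
Proof.
case=> uM MA _; rewrite /pairing.
have -> : (rmx (colcode A f (g k)))^T = col k (rmx M).
  by apply/colP=> i; rewrite -MA !mxE.
by rewrite -col_mulmx mulmxKV // !mxE.
Qed.

End Pairing.

(** * Maximal matrices contain every compatible row and column *)

Section Maximality.
Variable R : realType.
Local Open Scope ring_scope.

Definition trz (A : zo_matrix) : zo_matrix := ZoMatrix (entries A)^T.

Lemma trzK A : trz (trz A) = A.
Proof. by case: A => m n A; rewrite /trz /= trmxK. Qed.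

Lemma trz_rank_matrices d A :
  zo_rank_matrices R d A -> zo_rank_matrices R d (trz A).
Proof.
case: A => m n A [/= rA injr injc]; split => /=.
- by rewrite -[RHS]rA /real_rank /= -map_trmx mxrank_tr.
- by move=> i j; rewrite -!tr_col => /trmx_inj /injc.
- by move=> i j; rewrite -!tr_row => /trmx_inj /injr.
Qed.

Lemma trz_submatrix A B : submatrix A B -> submatrix (trz A) (trz B).
Proof.
by case=> f [g [hf hg AB]]; exists g, f; split=> //=; rewrite AB trmx_mxsub.
Qed.

Lemma trz_maximal d A : maximal_matrices R d A -> maximal_matrices R d (trz A).
Proof.
case=> rA maxA; split; first exact: trz_rank_matrices.
case=> B [rB neqB subB]; apply: maxA; exists (trz B); split.
- exact: trz_rank_matrices.
- by move=> BA; apply: neqB; rewrite -BA trzK.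
- by rewrite -(trzK A); exact: trz_submatrix.
Qed.

(* Otherwise the row given by [a] could be appended to [A]. *)
Lemma maximal_row d A M f g (a : 'rV[bool]_d) :
  maximal_matrices R d A -> frame R A M f g ->
  (forall j, compat R M a (colcode A f j)) -> exists i, rowcode A g i = a.
Proof.
case: A f g => m n A f g /= [[/= rA injr injc] maxA] frA cA.
apply: contrapT => nex; apply: maxA.
have {cA} /choice[t tE] : forall j, exists t : bool,
    pairing R M a (colcode A f j) = t%:R by move=> j; apply/compatP/cA.
pose r : 'rV[bool]_n := \row_j t j.
(* At the columns [g] the new row reads [a], so [a] is its code. *)
have rg k : r 0 (g k) = a 0 k.
  by apply: (@boolR_inj R); rewrite /= mxE -tE (frame_pairing _ _ frA).
exists (ZoMatrix (col_mx A r)); split=> /=; last 2 first.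
- move/(congr1 nrows) => /= /eqP.
  by rewrite -[X in _ == X]addn0 eqn_add2l.
- exists (lshift 1), id; split=> //=.
  by apply/matrixP=> i j; rewrite mxE col_mxEu.
split=> /=.
- rewrite -[RHS]rA /real_rank /= map_col_mx -addsmxE.
  apply/eqmx_rank/andP; split; last exact: addsmxSl.
  rewrite addsmx_sub submx_refl /=; apply/submxP.
  pose w := rmx R a *m invmx (rmx R M).
  (* The new row is [w] times the rows selected by [f]; summing [w] over the fibres of [f] gives
     coefficients for all rows of [A]. *)
  exists (\row_i \sum_(k | f k == i) w 0 k).
  apply/rowP=> j; rewrite [LHS]mxE [r _ _]mxE -tE /pairing [LHS]mxE [RHS]mxE.
  under [RHS]eq_bigr do rewrite mxE mulr_suml.
  rewrite (exchange_big_dep xpredT) //=; apply: eq_bigr => k _.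
  have -> : (rmx R (colcode A f j))^T k 0 = rmx R A (f k) j by rewrite !mxE.
  rewrite (big_pred1 (f k)) // => i; exact: eq_sym.
- move=> i i'; case: (splitP i) => [p|p] ip; case: (splitP i') => [q|q] iq.
  + have -> : i = lshift 1 p by apply: val_inj.
    have -> : i' = lshift 1 q by apply: val_inj.
    by rewrite !rowKu => /injr ->.
  + have -> : i = lshift 1 p by apply: val_inj.
    have -> : i' = rshift m q by apply: val_inj.
    (* If the new row equalled the old row [p], that row would have code [a]. *)
    rewrite rowKu rowKd => /rowP e; case: nex; exists p.
    by apply/rowP=> k; rewrite -rg; have := e (g k); rewrite !mxE.
  + have -> : i = rshift m p by apply: val_inj.
    have -> : i' = lshift 1 q by apply: val_inj.
    rewrite rowKu rowKd => /rowP e; case: nex; exists q.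
    by apply/rowP=> k; rewrite -rg; have := e (g k); rewrite !mxE.
  + by move=> _; apply: val_inj; rewrite /= ip iq !ord1.
- move=> j j'; rewrite !col_col_mx => /eq_col_mx[/injc //].
Qed.

Lemma maximal_col d A M f g (b : 'rV[bool]_d) :
  maximal_matrices R d A -> frame R A M f g ->
  (forall i, compat R M (rowcode A g i) b) -> exists j, colcode A f j = b.
Proof.
move=> /trz_maximal maxA /frame_tr frA cA.
have [j|j <-] := maximal_row maxA frA (a := b).
  apply/compat_tr; move: (cA j); congr (compat _ _ _ _).
  by apply/rowP=> k; rewrite !mxE.
by exists j; apply/rowP=> k; rewrite !mxE.
Qed.

End Maximality.

(** * Encoding a maximal matrix by data of bounded size *)

Section Codes.
Variable R : realType.
Local Open Scope ring_scope.

(* For [v = c b^T], the difference [v^2 - v] is the value at [b] of the quadratic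
   form [c^T c - diag c], because [b_i = b_i ^ 2]. *)
Definition quad d (M : 'M[bool]_d) (a : 'rV[bool]_d) : 'rV[R]_(d * d) :=
  let c := rmx R a *m invmx (rmx R M) in mxvec (c^T *m c - diag_mx c).

Lemma compat_quad d (M : 'M[bool]_d) (a b : 'rV[bool]_d) :
  compat R M a b <->
  quad M a *m (mxvec ((rmx R b)^T *m rmx R b))^T = 0.
Proof.
rewrite /compat /quad /pairing; set c := rmx R a *m _; set x := rmx R b.
have -> : mxvec (c^T *m c - diag_mx c) *m (mxvec (x^T *m x))^T =
    ((c *m x^T) 0 0 ^+ 2 - (c *m x^T) 0 0)%:M.
  (* Transposing puts the factors in the order of [mxvec_dotmul], which yields the quadratic form
     evaluated at [x]. *)
  rewrite -[LHS]trmxK trmx_mul trmxK mxvec_dotmul mulmxBr mulmxBl.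
  apply/matrixP=> i j; rewrite !ord1 [RHS]mxE eqxx mulr1n [LHS]mxE [LHS]mxE.
  rewrite [X in _ + X]mxE; congr (_ - _).
    rewrite mulmxA.
    have -> : x *m c^T = (c *m x^T)^T by rewrite [RHS]trmx_mul trmxK.
    by rewrite -mulmxA mxE big_ord1 [_^T _ _]mxE expr2.
  rewrite [LHS]mxE [RHS]mxE; apply: eq_bigr => k _; rewrite mul_mx_diag !mxE mulrAC mulrC; congr (_ * _).
  by case: (b 0 k); rewrite ?mulr1 ?mulr0.
split=> [->|/matrixP/(_ 0 0)]; first by rewrite subrr raddf0.
by rewrite !mxE eqxx mulr1n => /eqP; rewrite subr_eq0 => /eqP.
Qed.

(** The zero vector imposes no condition, so it can pad a list of row codes to length [d * d]. *)
Lemma compat0l d (M : 'M[bool]_d) b : compat R M (const_mx false) b.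
Proof.
apply/compatP; exists false; rewrite /pairing.
have -> : rmx R (const_mx false : 'rV_d) = 0 by apply/matrixP=> i j; rewrite !mxE.
by rewrite !mul0mx mxE.
Qed.

(** A fixed number [d * d] of tests, whatever the size of [A], lets the codes range over a finite
    type. *)
Definition has_code d (A : zo_matrix) (c : 'M[bool]_d * 'M[bool]_(d * d, d)) :=
  exists f g, frame R A c.1 f g /\
    forall b, (exists j, colcode A f j = b) <->
              (forall k, compat R c.1 (row k c.2) b).

(** The quadratic forms of the rows lie in a space of dimension [d * d]. If a basis chosen among
    them vanishes at [b], all of them do, and by maximality [b] is a column code. *)
Lemma exists_code d A :
  maximal_matrices R d A -> exists c, @has_code d A c.
Proof.
move=> maxA; have [[rA _ _] _] := maxA.
have [M [f [g frA]]] := exists_frame rA.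
pose Q := \matrix_i quad M (rowcode A g i).
pose K : 'M[bool]_(d * d, d) := \matrix_k
  (* [Q] may have rank below [d * d]; the remaining places hold the zero vector. *)
  (if insub (val k) is Some l then rowcode A g (maxrankfun Q l)
   else const_mx false).
exists (M, K), f, g; split=> // b; split=> [[j <-] k|cK] /=.
  rewrite rowK; case: insub => [l|]; first exact: frame_compat frA.
  exact: compat0l.
apply: (maximal_col maxA frA) => i; apply/compat_quad.
set y := (mxvec _)^T.
have Qy : rowsub (maxrankfun Q) Q *m y = 0.
  apply/row_matrixP=> l; rewrite row0 row_mul row_rowsub rowK.
  have ld : (l < d * d)%N by apply: leq_trans (ltn_ord l) (rank_leq_col Q).
  apply/compat_quad; have := cK (Ordinal ld).
  by rewrite /= rowK /= valK.
have /submxP[X ->] : (quad M (rowcode A g i) <= rowsub (maxrankfun Q) Q)%MS.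
  by rewrite eq_maxrowsub -[quad _ _](rowK (fun i => quad M (rowcode A g i))) row_sub.
by rewrite -mulmxA Qy mulmx0.
Qed.

(** Rows of [A] are compatible with all columns of [A], hence with those of [B]; maximality of [B]
    then puts their codes among its rows. *)
Lemma rowcode_transfer d (A B : zo_matrix) M fA gA fB gB :
  maximal_matrices R d B -> frame R A M fA gA -> frame R B M fB gB ->
  (forall j, exists j', colcode A fA j' = colcode B fB j) ->
  exists s : 'I_(nrows A) -> 'I_(nrows B),
    forall i, rowcode B gB (s i) = rowcode A gA i :> 'rV_d.
Proof.
move=> maxB frA frB AB.
suff /choice : forall i, exists i', rowcode B gB i' = rowcode A gA i.
  by case=> s sE; exists s.
move=> i; apply: (maximal_row maxB frB) => j.
by have [j' <-] := AB j; exact: frame_compat frA.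
Qed.

(** The size bounds turn the injections into bijections, and the common [M] computes equal entries
    from equal codes. *)
Lemma frame_perm_class d (A B : zo_matrix) M fA gA fB gB
    (s : 'I_(nrows A) -> 'I_(nrows B)) (t : 'I_(ncols A) -> 'I_(ncols B)) :
  frame R A M fA gA -> frame R B M fB gB ->
  injective s -> injective t ->
  (nrows B <= nrows A)%N -> (ncols B <= ncols A)%N ->
  (forall i, rowcode B gB (s i) = rowcode A gA i :> 'rV_d) ->
  (forall j, colcode B fB (t j) = colcode A fA j) ->
  perm_class B A.
Proof.
case: A B fA gA fB gB s t => [m n A] [m' n' B] /= fA gA fB gB s t.
move=> [_ _ prA] [_ _ prB] injs injt le_m le_n rowE colE.
have em : m' = m.
  by apply/eqP; rewrite eqn_leq le_m (leq_ord_inj injs).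
have en : n' = n.
  by apply/eqP; rewrite eqn_leq le_n (leq_ord_inj injt).
subst m' n'; exists (perm injs), (perm injt) => /=; congr ZoMatrix.
apply/matrixP=> i j; rewrite !mxE !permE; apply: (@boolR_inj R) => /=.
by rewrite prA prB rowE colE.
Qed.

Lemma perm_class_trans A B : perm_class B A -> (perm_class A `<=` perm_class B)%classic.
Proof.
case: B => m n B [s [t ->]] _ [/= s' [t' ->]].
exists (s' * s)%g, (t' * t)%g => /=; congr ZoMatrix.
by rewrite row_permM col_permM col_row_permC.
Qed.

(** The code fixes the set of column codes, and maximality then fixes the row codes. Injections in
    both directions make the sizes equal. *)
Lemma has_code_perm_class d A B c :
  maximal_matrices R d A -> maximal_matrices R d B ->
  @has_code d A c -> @has_code d B c -> perm_class A = perm_class B.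
Proof.
case: c => M K maxA maxB [fA [gA [/= frA cA]]] [fB [gB [/= frB cB]]].
have AB j : exists j', colcode A fA j' = colcode B fB j.
  by apply/cA/cB; exists j.
have BA j : exists j', colcode B fB j' = colcode A fA j.
  by apply/cB/cA; exists j.
have [s sE] := rowcode_transfer maxB frA frB AB.
have [s' s'E] := rowcode_transfer maxA frB frA BA.
have /choice[t tE] := BA; have /choice[t' t'E] := AB.
have colcode_inj E M' f g : maximal_matrices R d E -> frame R E M' f g ->
    injective (colcode E f : _ -> 'rV_d).
  move=> /trz_maximal[[_ injE _] _] /frame_tr frE j j' e.
  apply: (rowcode_inj frE injE); move/rowP: e => e.
  by apply/rowP=> k; have := e k; rewrite !mxE.
have rinj E M' f g : maximal_matrices R d E -> frame R E M' f g ->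
    injective (rowcode E g : _ -> 'rV_d).
  by move=> [[_ injE _] _] frE; exact: rowcode_inj frE injE.
have injs : injective s.
  by move=> i j e; apply: (rinj _ _ _ _ maxA frA); rewrite -!sE e.
have injs' : injective s'.
  by move=> i j e; apply: (rinj _ _ _ _ maxB frB); rewrite -!s'E e.
have injt : injective t.
  by move=> i j e; apply: (colcode_inj _ _ _ _ maxA frA); rewrite -!tE e.
have injt' : injective t'.
  by move=> i j e; apply: (colcode_inj _ _ _ _ maxB frB); rewrite -!t'E e.
apply/seteqP; split; apply: perm_class_trans.
- exact: (frame_perm_class frA frB injs injt (leq_ord_inj injs') (leq_ord_inj injt')).
- exact: (frame_perm_class frB frA injs' injt' (leq_ord_inj injs) (leq_ord_inj injt)).
Qed.

End Codes.

Local Open Scope classical_set_scope.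
Local Open Scope card_scope.

(* A #<= `I_n says that A is finite with at most n elements. *)
Theorem theorem4p1 (R : realType) :
  exists C : nat, forall d : nat,
    maximal_classes R d #<= `I_(2 ^ (C * d ^ 3))%N.
Proof.
(* There are [2 ^ (d ^ 2 + d ^ 3)] codes, and [d ^ 2 <= d ^ 3] holds also for [d = 0]. *)
exists 2 => d.
pose T : finType := ('M[bool]_d * 'M[bool]_(d * d, d))%type.
have cardT : (#|T| <= 2 ^ (2 * d ^ 3))%N.
  rewrite card_prod !card_mx card_bool -expnD leq_exp2l //.
  rewrite mul2n -addnn (_ : d ^ 3 = d * d * d)%N; last first.
    by rewrite !expnS expn0 muln1 mulnA.
  by rewrite leq_add2r; case: (d) => // n; rewrite leq_pmulr.
(* All maximal matrices with code [c] share one class, so the union of their classes is that class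
   and no representative has to be chosen. *)
pose class_of (c : T) : set zo_matrix :=
  [set B | exists A, [/\ maximal_matrices R d A, has_code R A c & perm_class A B]].
pose c0 : T := (const_mx false, const_mx false).
(* Indices past the end of [enum T] yield [c0]. They do no harm, since the image only has to cover
   the classes. *)
apply: card_le_trans (card_image_le (class_of \o nth c0 (enum T)) _).
apply: subset_card_le => _ [A maxA <-].
have [c codeA] := exists_code maxA.
exists (index c (enum T)) => /=.
  by apply: leq_trans cardT; rewrite cardE index_mem mem_enum.
rewrite nth_index ?mem_enum //; apply/seteqP; split=> [B [A' [maxA' codeA' AB]]|B AB].
  by rewrite (has_code_perm_class maxA maxA' codeA codeA').
by exists A.
Qed.
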